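(* Let $\nu\in\mathcal{P}_2(\mathbb{R}^d)$, $\Phi(\mu)=W_2^2(\mu,\nu)$ and, for $\delta\in(0,1)$, $\Phi_\delta(\mu)=\sup_{\mu'\in\mathcal{P}_2(\mathbb{R}^d)}\{W_2^2(\mu',\nu)-\frac1\delta W_2^2(\mu',\mu)\}$. Let $\mu\in\mathcal{P}_2(\mathbb{R}^d)$ be a point of differentiability of $\Phi$, let $(\delta_n)_{n\ge0}$ be a sequence in $(0,1)$ converging to $0$, and let $(\mu_n)_{n\ge0}$ be a sequence in $\mathcal{P}_2(\mathbb{R}^d)$ converging to $\mu$. Then for any sequence of couplings $(\gamma_n)_{n\ge0}$ with $\gamma_n\in\Pi(\mu,\mu_n)$ and $$\lim_{n\to\infty}\int_{\mathbb{R}^d\times\mathbb{R}^d}|x-y|^2\,\gamma_n(dx,dy)=0,$$ it holds that $$\lim_{n\to\infty}\int_{\mathbb{R}^d\times\mathbb{R}^d}|D_\mu\Phi_{\delta_n}(\mu_n,y)-D_\mu\Phi(\mu,x)|^2\,\gamma_n(dx,dy)=0.$$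
   Context: $\mathcal{P}_2(\mathbb{R}^d)$ is the set of Borel probability measures on $\mathbb{R}^d$ with finite second moment, with the Wasserstein distance $W_2^2(\mu,\nu)=\inf_{\gamma\in\Pi(\mu,\nu)}\int|x-y|^2\gamma(dx,dy)$, where $\Pi(\mu,\nu)$ is the set of couplings of $\mu$ and $\nu$ (first marginal $\mu$, second marginal $\nu$). A function $\Psi:\mathcal{P}_2(\mathbb{R}^d)\to\mathbb{R}$ is differentiable at $\mu$ if there is $\psi\in L^2_\mu(\mathbb{R}^d,\mathbb{R}^d)$ such that for all $\mu'\in\mathcal{P}_2(\mathbb{R}^d)$ and $\gamma\in\Pi(\mu,\mu')$, $\Psi(\mu')-\Psi(\mu)=\int\psi(x)\cdot(y-x)\gamma(dx,dy)+o\big((\int|x-y|^2\gamma(dx,dy))^{1/2}\big)$; then one writes $D_\mu\Psi(\mu,x)=\psi(x)$. For every $\delta\in(0,1)$, $\Phi_\delta$ is differentiable at every point of $\mathcal{P}_2(\mathbb{R}^d)$. *)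

(* Defs.v *)
From HB Require Import structures.
From mathcomp Require Import all_boot all_order all_algebra.
From mathcomp Require Import all_classical all_reals all_analysis.

Set Implicit Arguments.
Unset Strict Implicit.
Unset Printing Implicit Defensive.

Import Order.TTheory GRing.Theory Num.Theory.
Import numFieldNormedType.Exports.

Local Open Scope classical_set_scope.
Local Open Scope ring_scope.

(* 'rV[R]_d carries its Borel sigma-algebra; its topology is the product
   topology, hence also the Euclidean one. *)
Section rV_borel.
Variables (R : realType) (d : nat).

Let borel : set (set 'rV[R]_d) := <<s [set A : set 'rV[R]_d | open A] >>.

Let borel0 : borel set0.
Proof. exact: sigma_algebra0. Qed.

Let borelC A : borel A -> borel (~` A).
Proof. exact: sigma_algebraC. Qed.

Let borelU (F : (set 'rV[R]_d)^nat) :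
  (forall i, borel (F i)) -> borel (\bigcup_i F i).
Proof. exact: sigma_algebra_bigcup. Qed.

HB.instance Definition _ :=
  @isMeasurable.Build (sigma_display [set A : set 'rV[R]_d | open A])
    'rV[R]_d borel borel0 borelC borelU.

End rV_borel.

Section wasserstein.
Variables (R : realType) (d : nat).
Local Notation Rd := 'rV[R]_d.

Definition dotrv (x y : Rd) : R := \sum_(i < d) x ord0 i * y ord0 i.

(* The norm of the library on 'rV[R]_d is the sup norm, hence this
   definition of the squared Euclidean norm. *)
Definition sqnorm (x : Rd) : R := dotrv x x.

Record P2 := MkP2 {
  P2_prob :> probability Rd R;
  P2_moment : (\int[P2_prob]_x (sqnorm x)%:E < +oo)%E }.

(* The marginals are only compared on measurable sets: the value of a measure
   elsewhere is meaningless. *)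
Definition coupling (mu nu : P2) : set (probability (Rd * Rd)%type R) :=
  [set gamma | (forall A, measurable A -> gamma (fst @^-1` A) = mu A) /\
               (forall B, measurable B -> gamma (snd @^-1` B) = nu B)].

Definition cost (gamma : probability (Rd * Rd)%type R) : \bar R :=
  (\int[gamma]_z (sqnorm (z.1 - z.2))%:E)%E.

(* The infimum is finite, since the second moments are. *)
Definition W2sq (mu nu : P2) : R :=
  fine (ereal_inf [set cost gamma | gamma in coupling mu nu]).

Definition W2 (mu nu : P2) : R := Num.sqrt (W2sq mu nu).

Definition L2vec (mu : P2) (psi : Rd -> Rd) : Prop :=
  measurable_fun setT psi /\ (\int[mu]_x (sqnorm (psi x))%:E < +oo)%E.

(* [is_Dmu Psi mu psi]: Psi is differentiable at mu and psi is a version of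
   D_mu Psi (mu, .), which is determined only mu-almost everywhere. The
   remainder is uniform over mu' and gamma. *)
Definition is_Dmu (Psi : P2 -> R) (mu : P2) (psi : Rd -> Rd) : Prop :=
  L2vec mu psi /\
  forall eps : R, 0 < eps -> exists2 eta : R, 0 < eta &
    forall (mu' : P2) (gamma : probability (Rd * Rd)%type R),
      coupling mu mu' gamma -> Num.sqrt (fine (cost gamma)) < eta ->
      `|Psi mu' - Psi mu - \int[gamma]_z dotrv (psi z.1) (z.2 - z.1)|
        <= eps * Num.sqrt (fine (cost gamma)).

Definition Phi (nu mu : P2) : R := W2sq mu nu.

(* For 0 < delta < 1 the set is bounded above, by W2sq mu nu / (1 - delta). *)
Definition Phi_reg (nu : P2) (delta : R) (mu : P2) : R :=
  sup [set W2sq mu' nu - delta^-1 * W2sq mu' mu | mu' in [set: P2]].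

End wasserstein.

(* Main.v *)
(* Lifted to random variables, [Phi] minus [|X|^2] is concave, and so is
   [Phi_reg nu delta] minus [|X|^2 / (1 - delta)]: a sup-convolution of
   semiconcave functions. Hence the gradient [p'] of [Phi_reg] at [X'] is a
   superdifferential with error [|Y - X'|^2 / (1 - delta)], and
   [Phi Y <= Phi_reg Y], [Phi_reg X' <= Phi X' / (1 - delta)]. Testing this with
   [Y = X' - r (p' - p) / |p' - p|], where [p] is the gradient of [Phi] at [X],
   and expanding [Phi Y] and [Phi X'] at [X], bounds [r |p' - p|] by
   [O(delta) + o(r) + O(r^2)] once [|X' - X| <= r]. Couplings that share a
   marginal are glued only approximately, through a countable partition into
   small cells, which avoids disintegration. *)

Require Import Defs.
From HB Require Import structures.
From mathcomp Require Import all_boot all_order all_algebra.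
From mathcomp Require Import all_classical all_reals all_analysis.
From mathcomp Require Import measurable_realfun ring lra.

Set Implicit Arguments.
Unset Strict Implicit.
Unset Printing Implicit Defensive.

Import Order.TTheory GRing.Theory Num.Theory.
Import numFieldNormedType.Exports.
Local Open Scope classical_set_scope.
Local Open Scope ring_scope.

(** * Measurability of maps into R^d *)

Section measurable_rV.
Context {R : realType} {d : nat}.
Local Notation Rd := 'rV[R]_d.

Lemma measurable_coord (i : 'I_d) : measurable_fun setT (fun x : Rd => x ord0 i).
Proof.
apply: (measurability _ (measurable_realfun.RGenOpens.measurableE R)).
move=> _ [_ [a [b ->]] <-]; rewrite setTI.
apply: sub_sigma_algebra => /=.
apply: (@open_comp _ _ (fun x : Rd => x ord0 i)); last exact: interval_open.
by move=> x _; exact: coord_continuous.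
Qed.

(** Balls with rational centre and radius form a countable base; the index type is countable, so
    open sets become countable unions of boxes. *)
Lemma open_rV_bigcup (U : set Rd) : open U ->
  U = \bigcup_(q in [set q : 'rV[rat]_d * rat |
        ball (map_mx ratr q.1 : Rd) (ratr q.2 : R) `<=` U])
      ball (map_mx ratr q.1 : Rd) (ratr q.2 : R).
Proof.
move=> oU; apply/seteqP; split=> [x Ux|x [q /= qU qx]]; last exact: qU.
have /nbhs_ballP[e /= e0 eU] : nbhs x U by exact: open_nbhs_nbhs.
have [r /andP[r0 re]] : exists r : rat, 0 < (ratr r : R) < e / 2.
  have [r] := @rat_in_itvoo R 0 (e / 2) ltac:(by rewrite divr_gt0).
  by rewrite in_itv/=; exists r.
(* A rational centre within [r] of [x]: two radii [r] fit in [e], so the ball around this centre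
   stays in [ball x e]. *)
have Hq (i : 'I_d) : exists q : rat, x ord0 i - ratr r < (ratr q : R) < x ord0 i.
  have [q] := @rat_in_itvoo R (x ord0 i - ratr r) (x ord0 i) ltac:(by rewrite ltrBlDr ltrDl).
  by rewrite in_itv/=; exists q.
pose q := \row_i projT1 (cid (Hq i)).
have qx : ball (map_mx ratr q : Rd) (ratr r : R) x.
  split => // i j; rewrite (ord1 i) /ball/= !mxE; case: cid => p /= /andP[p1 p2].
  by rewrite ltr_distl p1/= (lt_trans p2)// ltrDl.
exists (q, r) => //= y qy; apply: eU.
apply: (@le_ball _ _ _ (ratr r + ratr r)); first by rewrite (splitr e) lerD// ltW.
exact: ball_triangle (ball_sym qx) qy.
Qed.

(** Open sets generate, each is a countable union of balls, and a sup-norm ball is a box, that is, a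
    finite intersection of conditions on single coordinates. *)
Lemma measurable_rV {dO} {O : measurableType dO} (f : O -> Rd) :
  (forall i, measurable_fun setT (fun w => f w ord0 i)) -> measurable_fun setT f.
Proof.
move=> mf; apply: (@measurability _ _ _ _ _ _ [set A : set Rd | open A]) => //.
move=> _ [U oU <-]; rewrite setTI (open_rV_bigcup oU).
rewrite preimage_bigcup bigcup_mkcond.
apply: countable_bigcupT_measurable; first exact: countableP.
move=> q /=; case: ifP => // _.
(* Membership in a ball includes positivity of its radius, which the intersection over coordinates
   does not see when [d = 0]. *)
rewrite (_ : _ @^-1` _ = if 0 < (ratr q.2 : R) then
   \bigcap_(i in [set: 'I_d]) ((fun w => f w ord0 i) @^-1`
     (ball (ratr (q.1 ord0 i) : R) (ratr q.2 : R)))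
   else set0); last first.
  apply/seteqP; split=> w /=.
    move=> [q0 qw]; rewrite q0 => i _ /=; have := qw ord0 i.
    by rewrite !mxE.
  case: ifP => // q0 qw; split => // i j; rewrite ord1 !mxE.
  exact: (qw j I).
case: ifP => // q0.
apply: fin_bigcap_measurable => //.
move=> i _; rewrite -[X in measurable X]setTI; apply: mf => //.
by apply: open_measurable; exact: ball_open.
Qed.

Lemma measurable_rVD {dO} {O : measurableType dO} (f g : O -> Rd) :
  measurable_fun setT f -> measurable_fun setT g -> measurable_fun setT (fun w => f w + g w).
Proof.
move=> mf mg; apply: measurable_rV => i.
under eq_fun do rewrite mxE.
by apply: measurable_funD; apply: (measurableT_comp (measurable_coord i)).
Qed.

Lemma measurable_rVZ {dO} {O : measurableType dO} (c : R) (f : O -> Rd) :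
  measurable_fun setT f -> measurable_fun setT (fun w => c *: f w).
Proof.
move=> mf; apply: measurable_rV => i.
under eq_fun do rewrite mxE.
by apply: measurable_funM => //; apply: (measurableT_comp (measurable_coord i)).
Qed.

Lemma measurable_dotrv {dO} {O : measurableType dO} (f g : O -> Rd) :
  measurable_fun setT f -> measurable_fun setT g ->
  measurable_fun setT (fun w => dotrv (f w) (g w)).
Proof.
move=> mf mg; apply: measurable_sum => i.
by apply: measurable_funM; apply: (measurableT_comp (measurable_coord i)).
Qed.

End measurable_rV.

(** * Laws of random variables and change of variables *)

Section image_law.
Context {R : realType}.

(** A relation rather than an equation with the pushforward: laws are compared on measurable sets
    only, so marginals of couplings fit the same format. *)
Definition image_law {d1 d2} {T1 : measurableType d1} {T2 : measurableType d2}
    (P : probability T1 R) (f : T1 -> T2) (Q : probability T2 R) :=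
  measurable_fun setT f /\ forall A, measurable A -> P (f @^-1` A) = Q A.

Context {d1 d2} {T1 : measurableType d1} {T2 : measurableType d2}.
Variables (P : probability T1 R) (f : T1 -> T2).

Lemma image_law_exists : measurable_fun setT f ->
  exists Q : probability T2 R, image_law P f Q.
Proof.
move=> mf.
pose X : {RV P >-> T2} := HB.pack f (isMeasurableFun.Build _ _ _ _ f mf).
by exists (distribution P X).
Qed.

Lemma ge0_integral_image_law (Q : probability T2 R) (g : T2 -> \bar R) :
  image_law P f Q -> measurable_fun setT g -> (forall y, 0 <= g y)%E ->
  (\int[Q]_y g y = \int[P]_x g (f x))%E.
Proof.
move=> [mf fQ] mg g0.
pose X : {RV P >-> T2} := HB.pack f (isMeasurableFun.Build _ _ _ _ f mf).
rewrite (@eq_measure_integral _ _ _ _ (distribution P X)) => [|A mA _].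
  by rewrite ge0_integral_distribution.
exact/esym/fQ.
Qed.

Lemma Rintegral_image_law (Q : probability T2 R) (g : T2 -> R) :
  image_law P f Q -> measurable_fun setT g ->
  \int[Q]_y g y = \int[P]_x g (f x).
Proof.
move=> fQ mg; rewrite /Rintegral; congr fine.
have mEg : measurable_fun setT (EFin \o g) by exact/measurable_EFinP.
rewrite integralE [in RHS]integralE.
rewrite (ge0_integral_image_law fQ (measurable_funepos mEg))//.
rewrite (ge0_integral_image_law fQ (measurable_funeneg mEg))//.
by congr (_ - _)%E; apply: eq_integral => x _; rewrite ?funeposE ?funenegE.
Qed.

Lemma image_law_comp {d3} {T3 : measurableType d3} (g : T2 -> T3)
    (Q : probability T2 R) (S : probability T3 R) :
  image_law P f Q -> image_law Q g S -> image_law P (g \o f) S.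
Proof.
move=> [mf fQ] [mg gS]; split; first exact: measurableT_comp.
move=> A mA; rewrite comp_preimage fQ ?gS// -[X in measurable X]setTI.
exact: mg.
Qed.

End image_law.

(** * Gluing two spaces along countably valued labels of equal law *)

Section discrete_glue.
Context {R : realType} {d1 d2} {T1 : measurableType d1} {T2 : measurableType d2}.
Variables (PA : probability T1 R) (PB : probability T2 R).
Variables (c1 : T1 -> nat) (c2 : T2 -> nat).
Hypothesis mc1 : measurable_fun setT c1.
Hypothesis mc2 : measurable_fun setT c2.
Hypothesis cE : forall k, PA (c1 @^-1` [set k]) = PB (c2 @^-1` [set k]).

Let m1 k : measurable (c1 @^-1` [set k]).
Proof. by rewrite -[X in measurable X]setTI; exact: mc1. Qed.
Let m2 k : measurable (c2 @^-1` [set k]).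
Proof. by rewrite -[X in measurable X]setTI; exact: mc2. Qed.

Let mem_fiber {T : Type} (c : T -> nat) k x : (x \in c @^-1` [set k]) = (c x == k).
Proof. by apply/idP/idP; rewrite inE => /eqP. Qed.

Let w k : R := (fine (PA (c1 @^-1` [set k])))^-1.

(* Density of the glued measure with respect to the product measure: given
   [c1 z.1 = c2 z.2], the two coordinates are independent. On null fibres the
   weight is the junk value [0^-1 = 0]. *)
Let dens (z : T1 * T2) : \bar R := (w (c1 z.1) * (c1 z.1 == c2 z.2)%:R)%:E.

Let w0 k : 0 <= w k.
Proof. by rewrite invr_ge0 fine_ge0. Qed.

Let dens0 z : (0 <= dens z)%E.
Proof. by rewrite lee_fin mulr_ge0. Qed.

Let diag : set (T1 * T2) := [set z | c1 z.1 == c2 z.2].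

Let mdiag : measurable diag.
Proof.
rewrite (_ : diag = \bigcup_k ((c1 @^-1` [set k]) `*` (c2 @^-1` [set k]))).
  by apply: bigcupT_measurable => k; exact: measurableX.
apply/seteqP; split=> [z /= /eqP cz|z [k _] [/= z1 z2]].
  by exists (c2 z.2) => //; split.
by rewrite /diag /= z1 z2.
Qed.

Let mdens : measurable_fun setT dens.
Proof.
apply/measurable_EFinP; apply: measurable_funM.
  apply: (@measurableT_comp _ _ _ _ _ _ w) => //.
  exact: (@measurableT_comp _ _ _ _ _ _ c1).
rewrite (_ : (fun _ => _) = \1_diag); last first.
  apply/funext => z; rewrite indicE.
  by have -> : (z \in diag) = (c1 z.1 == c2 z.2) by apply/idP/idP; rewrite inE.
exact: measurable_indic.
Qed.

Let glue (S : set (T1 * T2)) : \bar R := (\int[PA \x PB]_(z in S) dens z)%E.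

Let glue00 : glue set0 = 0%E.
Proof. exact: integral_set0. Qed.

Let glue_ge0 S : (0 <= glue S)%E.
Proof. exact: integral_ge0. Qed.

Let glue_sigma : semi_sigma_additive glue.
Proof.
move=> F mF tF mUF; rewrite /glue ge0_integral_bigcup//.
  by apply: is_cvg_nneseries => *; exact: integral_ge0.
exact: measurable_funTS.
Qed.

HB.instance Definition _ := isMeasure.Build _ _ _ glue glue00 glue_ge0 glue_sigma.

Let slice1 (x : T1) : (\int[PB]_y dens (x, y) = (w (c1 x))%:E * PA (c1 @^-1` [set c1 x]))%E.
Proof.
rewrite (eq_integral (fun y => (w (c1 x))%:E * (\1_(c2 @^-1` [set c1 x]) y)%:E)%E); last first.
  by move=> y _; rewrite /dens /= EFinM indicE eq_sym mem_fiber.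
rewrite ge0_integralZl_EFin//; last exact/measurable_EFinP/measurable_indic.
by rewrite integral_indic// setIT cE.
Qed.

Let slice2 (y : T2) : (\int[PA]_x dens (x, y) = (w (c2 y))%:E * PA (c1 @^-1` [set c2 y]))%E.
Proof.
rewrite (eq_integral (fun x => (w (c2 y))%:E * (\1_(c1 @^-1` [set c2 y]) x)%:E)%E); last first.
  move=> x _; rewrite /dens /= EFinM indicE mem_fiber.
  by case: eqP => [->//|_]; rewrite !mule0.
rewrite ge0_integralZl_EFin//; last exact/measurable_EFinP/measurable_indic.
by rewrite integral_indic// setIT.
Qed.

(** The product is 1 except on fibres of mass zero, and these are countably many. Stated for any [P]
    and [c] with the same label law, to serve both marginals. *)
Let ae_one {d0} {T : measurableType d0} (P : probability T R) (c : T -> nat) :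
  measurable_fun setT c ->
  (forall k, P (c @^-1` [set k]) = PA (c1 @^-1` [set k])) ->
  {ae P, forall x, setT x -> (w (c x))%:E * PA (c1 @^-1` [set c x]) = 1%E}%E.
Proof.
move=> mc cP; pose N k := if P (c @^-1` [set k]) == 0%E then c @^-1` [set k] else set0.
have mck k : measurable (c @^-1` [set k]).
  by rewrite -[X in measurable X]setTI; exact: mc.
apply: (negligibleS (A := \bigcup_k N k)); last first.
  apply: negligible_bigcup => k; rewrite /N; case: ifPn => [/eqP k0|_].
    by exists (c @^-1` [set k]); split.
  exact: negligible_set0.
move=> x /= /not_implyP[_]; apply: contra_notP => xN.
have : P (c @^-1` [set c x]) != 0%E.
  apply: contra_notN xN => Pk; exists (c x) => //.
  by rewrite /N Pk.
rewrite cP => n0; rewrite /w -[X in (_ * X)%E]fineK; last exact: fin_num_measure.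
by rewrite -EFinM mulVf// fine_eq0// fin_num_measure.
Qed.

(** By Tonelli, integrating [dens] over one coordinate leaves the factor of [ae_one], which is 1
    almost everywhere, so both marginals are correct. The labels agree almost everywhere because
    [dens] vanishes off [diag]. *)
Lemma discrete_glue : exists Q : probability (T1 * T2)%type R,
  [/\ image_law Q fst PA, image_law Q snd PB &
      {ae Q, forall z, c1 z.1 = c2 z.2}].
Proof.
have fst_glue A : measurable A -> glue (fst @^-1` A) = PA A.
  move=> mA; rewrite /glue.
  have mA' : measurable (fst @^-1` A : set (T1 * T2)).
    by rewrite -[X in measurable X]setTI; exact: measurable_fst.
  rewrite integral_mkcond/=.
  rewrite fubini_tonelli1//; last 2 first.
  - exact/(measurable_restrictT _ mA')/measurable_funTS.
  - by move=> z; rewrite /patch; case: ifP.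
  rewrite (eq_integral (fun x => (\1_A x)%:E *
    ((w (c1 x))%:E * PA (c1 @^-1` [set c1 x])))%E); last first.
    move=> x _; rewrite /fubini_F /patch -slice1 indicE.
    have -> : (fun y : T2 => if (x, y) \in fst @^-1` A then dens (x, y) else 0%E) =
       (fun y => if x \in A then dens (x, y) else 0%E).
      by apply/funext => y; congr (if _ then _ else _); apply/idP/idP; rewrite !inE.
    case: (x \in A); first by rewrite mul1e.
    by rewrite mul0e integral0.
  rewrite (ae_eq_integral (fun x => (\1_A x)%:E))//; first by rewrite integral_indic// setIT.
  - apply: emeasurable_funM; first exact/measurable_EFinP/measurable_indic.
    apply: (@measurableT_comp _ _ _ _ _ _ (fun k => (w k)%:E * PA (c1 @^-1` [set k]))%E) => //.
  - exact/measurable_EFinP/measurable_indic.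
  - apply: filterS (@ae_one _ _ PA c1 mc1 (fun k => erefl)) => x /(_ I) /= + _.
    by move=> ->; rewrite mule1.
have snd_glue A : measurable A -> glue (snd @^-1` A) = PB A.
  move=> mA; rewrite /glue.
  have mA' : measurable (snd @^-1` A : set (T1 * T2)).
    by rewrite -[X in measurable X]setTI; exact: measurable_snd.
  rewrite integral_mkcond/=.
  rewrite fubini_tonelli2//; last 2 first.
  - exact/(measurable_restrictT _ mA')/measurable_funTS.
  - by move=> z; rewrite /patch; case: ifP.
  rewrite (eq_integral (fun x => (\1_A x)%:E *
    ((w (c2 x))%:E * PA (c1 @^-1` [set c2 x])))%E); last first.
    move=> y _; rewrite /fubini_G /patch -slice2 indicE.
    have -> : (fun x : T1 => if (x, y) \in snd @^-1` A then dens (x, y) else 0%E) =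
       (fun x => if y \in A then dens (x, y) else 0%E).
      by apply/funext => x; congr (if _ then _ else _); apply/idP/idP; rewrite !inE.
    case: (y \in A); first by rewrite mul1e.
    by rewrite mul0e integral0.
  rewrite (ae_eq_integral (fun x => (\1_A x)%:E))//; first by rewrite integral_indic// setIT.
  - apply: emeasurable_funM; first exact/measurable_EFinP/measurable_indic.
    apply: (@measurableT_comp _ _ _ _ _ _ (fun k => (w k)%:E * PA (c1 @^-1` [set k]))%E) => //.
  - exact/measurable_EFinP/measurable_indic.
  - apply: filterS (@ae_one _ _ PB c2 mc2 (fun k => esym (cE k))) => x /(_ I) /= + _.
    by move=> ->; rewrite mule1.
have glueT : glue setT = 1%E.
  by rewrite -(preimage_setT fst) fst_glue// probability_setT.
pose Q : probability (T1 * T2)%type R :=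
  HB.pack glue (Measure_isProbability.Build _ _ _ glue glueT).
exists Q; split.
- by split; [exact: measurable_fst|exact: fst_glue].
- by split; [exact: measurable_snd|exact: snd_glue].
- exists (~` diag); split; first exact: measurableC.
    rewrite /= /glue integral0_eq// => z /= /negP/negPf.
    by rewrite /dens => ->; rewrite mulr0.
  by move=> z /= + /eqP.
Qed.

End discrete_glue.

(** * Quadratic inequalities for the Euclidean norm *)

Section sqnorm_theory.
Context {R : realType} {d : nat}.
Implicit Types x y z : 'rV[R]_d.

Lemma sqnorm_ge0 x : 0 <= sqnorm x.
Proof. by apply: sumr_ge0 => i _; rewrite -expr2 sqr_ge0. Qed.

Lemma sqnorm_subC x y : sqnorm (x - y) = sqnorm (y - x).
Proof. by apply: eq_bigr => i _; rewrite !mxE; ring. Qed.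

Lemma sqnormZ c x : sqnorm (c *: x) = c ^+ 2 * sqnorm x.
Proof. by rewrite /sqnorm /dotrv mulr_sumr; apply: eq_bigr => i _; rewrite !mxE; ring. Qed.

Lemma dotrvZr c x y : dotrv x (c *: y) = c * dotrv x y.
Proof. by rewrite /dotrv mulr_sumr; apply: eq_bigr => i _; rewrite !mxE; ring. Qed.

Lemma dotrvDr x y z : dotrv x (y + z) = dotrv x y + dotrv x z.
Proof. by rewrite /dotrv -big_split; apply: eq_bigr => i _ /=; rewrite !mxE; ring. Qed.

Lemma dotrvBl x y z : dotrv (x - y) z = dotrv x z - dotrv y z.
Proof. by rewrite /dotrv -sumrB; apply: eq_bigr => i _; rewrite !mxE; ring. Qed.

Lemma sqnormD_le x y : sqnorm (x + y) <= 2 * sqnorm x + 2 * sqnorm y.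
Proof.
rewrite /sqnorm /dotrv !mulr_sumr -big_split; apply: ler_sum => i _ /=.
by rewrite !mxE; have := sqr_ge0 (x ord0 i - y ord0 i); nra.
Qed.

(** A crude constant is enough: the bound serves to make scalar products of square-integrable
    vectors integrable. *)
Lemma normr_dotrv_le x y : `|dotrv x y| <= sqnorm x + sqnorm y.
Proof.
rewrite /sqnorm /dotrv -big_split; apply: le_trans (ler_norm_sum _ _ _) _.
apply: ler_sum => i _ /=.
move: (x _ _) (y _ _) => u v.
rewrite ler_norml; apply/andP; split; rewrite -subr_ge0.
  have -> : u * v - - (u * u + v * v) = 2^-1 * ((u + v) ^+ 2 + u ^+ 2 + v ^+ 2) by field.
  by rewrite mulr_ge0 ?addr_ge0 ?sqr_ge0.
have -> : u * u + v * v - u * v = 2^-1 * ((u - v) ^+ 2 + u ^+ 2 + v ^+ 2) by field.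
by rewrite mulr_ge0 ?addr_ge0 ?sqr_ge0.
Qed.

(** In each coordinate the defect is a perfect square divided by [a * b]. *)
Lemma sqnorm_sub_young (a b : R) x y z : 0 < a -> 0 < b -> a + b = 1 ->
  sqnorm (x - z) <= a^-1 * sqnorm (x - y) + b^-1 * sqnorm (y - z).
Proof.
move=> a0 b0 ab; rewrite /sqnorm /dotrv !mulr_sumr -big_split.
apply: ler_sum => i _ /=; rewrite !mxE.
set u := x _ _; set v := y _ _; set t := z _ _.
rewrite -subr_ge0.
have -> : a^-1 * ((u - v) * (u - v)) + b^-1 * ((v - t) * (v - t)) - (u - t) * (u - t)
   = (b * (u - v) - a * (v - t)) ^+ 2 / (a * b).
  have -> : b = 1 - a by rewrite -ab; ring.
  field.
  by apply/andP; split; apply: lt0r_neq0; [lra|].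
by rewrite divr_ge0 ?sqr_ge0// mulr_ge0// ltW.
Qed.

(* Concavity of [-t * (1 - t) * |x' - y|^2] absorbed by Young's inequality for
   [x' - y = (x' - x) + (x - y)] with weights [delta] and [1 - delta]. *)
Lemma sqnorm_interp (delta t : R) x x' y z : 0 < delta < 1 -> 0 <= t <= 1 ->
  (1 - t) * sqnorm (x' - z) + t * sqnorm (y - z) + delta^-1 *
    sqnorm ((1 - t) *: x' + t *: y - ((1 - t) *: x + t *: y)) <=
  1 * sqnorm ((1 - t) *: x' + t *: y - z) + (1 - t) / delta * sqnorm (x' - x) +
    t * (1 - t) / (1 - delta) * sqnorm (y - x).
Proof.
move=> /andP[d0 d1] /andP[t0 t1].
have dd : 0 < 1 - delta by lra.
have dne : delta != 0 by apply: lt0r_neq0.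
have ddne : 1 - delta != 0 by apply: lt0r_neq0.
rewrite /sqnorm /dotrv !mulr_sumr -!big_split.
apply: ler_sum => i _ /=; rewrite !mxE.
move: (x _ _) (x' _ _) (y _ _) (z _ _) => u u' v w.
rewrite -subr_ge0.
set E := (X in 0 <= X).
have -> : E = t * (1 - t) *
    (((1 - delta) * (u' - u) - delta * (u - v)) ^+ 2 / (delta * (1 - delta))).
  by rewrite /E; field; rewrite dne ddne.
apply: mulr_ge0; first by apply: mulr_ge0; lra.
by rewrite divr_ge0 ?sqr_ge0// mulr_ge0// ltW.
Qed.

End sqnorm_theory.

(** * Partition of R^d into small cubes, and approximate gluing *)

Section cell.
Context {R : realType} {d : nat}.
Variable h : R.

Let grid (x : 'rV[R]_d) : 'rV[int]_d := \row_i Num.floor (x ord0 i / h).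

(** The half-open cube of side [h] containing [x], coded as a natural number to serve as a label for
    [discrete_glue]. *)
Definition cell (x : 'rV[R]_d) : nat := pickle (grid x).

Lemma measurable_cell : measurable_fun setT cell.
Proof.
move=> _ B _; rewrite setTI.
have -> : cell @^-1` B = \bigcup_(m : 'rV[int]_d)
    (if pickle m \in B then grid @^-1` [set m] else set0).
  apply/seteqP; split=> [x Bx|x [m _]].
    by exists (grid x) => //; rewrite mem_set.
  by case: ifPn => // /set_mem Bm /= xm; rewrite /cell xm.
apply: countable_bigcupT_measurable; first exact: countableP.
move=> m; case: ifP => // _.
have -> : grid @^-1` [set m] = \bigcap_(i in [set: 'I_d])
    ((fun x : 'rV[R]_d => x ord0 i / h) @^-1` `[(m ord0 i)%:~R, (m ord0 i + 1)%:~R[).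
  apply/seteqP; split=> x /=.
    move=> <- i _ /=; rewrite in_itv/= mxE.
    by rewrite -archimedean.Num.Theory.floor_eq.
  move=> xm; apply/rowP => i; rewrite mxE.
  apply/eqP; rewrite archimedean.Num.Theory.floor_eq.
  by have := xm i I; rewrite /= in_itv.
apply: fin_bigcap_measurable => // i _; rewrite -[X in measurable X]setTI.
have mi : measurable_fun setT (fun x : 'rV[R]_d => x ord0 i / h).
  by apply: measurable_funM => //; exact: measurable_coord.
exact: mi.
Qed.

Lemma cell_sqnorm x y : 0 < h -> cell x = cell y -> sqnorm (x - y) <= d%:R * h ^+ 2.
Proof.
move=> h0 /(pcan_inj pickleK) /rowP xy.
rewrite mulr_natl -[X in _ *+ X](card_ord d) -sumr_const.
rewrite /sqnorm /dotrv; apply: ler_sum => i _; rewrite !mxE -expr2.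
have := xy i; rewrite !mxE => /eqP; rewrite archimedean.Num.Theory.floor_eq.
have := archimedean.Num.Theory.floor_itv (y ord0 i / h).
set k := Num.floor _; rewrite intrD.
rewrite !ler_pdivlMr// !ltr_pdivrMr// => /andP[y1 y2] /andP[x1 x2].
by move: y1 y2 x1 x2; rewrite mulrDl mul1r -subr_ge0 subr_sqr => y1 y2 x1 x2;
  apply: mulr_ge0; lra.
Qed.

End cell.

(** The cells of [Y1] and [Y2] have the same law, since both variables have law [mu]. Gluing along
    these labels puts [Y1] and [Y2] in a common small cube. *)
Lemma approx_glue {R : realType} {d : nat} {d1 d2} {T1 : measurableType d1}
    {T2 : measurableType d2} (PA : probability T1 R) (PB : probability T2 R)
    (Y1 : T1 -> 'rV[R]_d) (Y2 : T2 -> 'rV[R]_d) (mu : probability 'rV[R]_d R) (e : R) :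
  image_law PA Y1 mu -> image_law PB Y2 mu -> 0 < e ->
  exists Q : probability (T1 * T2)%type R,
  [/\ image_law Q fst PA, image_law Q snd PB &
      {ae Q, forall z, sqnorm (Y1 z.1 - Y2 z.2) <= e}].
Proof.
move=> [mY1 Y1mu] [mY2 Y2mu] e0.
(* As [h <= 1], the squared diameter satisfies [d h^2 <= d h <= e]; the successor keeps the quotient
   meaningful for [d = 0]. *)
pose h := Num.min 1 (e / d.+1%:R).
have h0 : 0 < h by rewrite lt_min ltr01 divr_gt0.
have dh : d%:R * h ^+ 2 <= e.
  have h1 : h <= 1 by rewrite ge_min lexx.
  have he : h * d.+1%:R <= e by rewrite -ler_pdivlMr// ge_min lexx orbT.
  have d0 : (0 : R) <= d%:R by [].
  move: he; rewrite -natr1 => he.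
  have : h ^+ 2 <= h by rewrite expr2 ler_piMr// ltW.
  move=> hh; apply: le_trans he; rewrite mulrDr mulr1.
  by rewrite (le_trans (ler_wpM2l d0 hh))// mulrC lerDl ltW.
have mc := @measurable_cell R d h.
have [|//|k|Q [Q1 Q2 Qae]] := @discrete_glue R _ _ T1 T2 PA PB (cell h \o Y1) (cell h \o Y2).
- exact: measurableT_comp.
- exact: measurableT_comp.
- have mk : measurable (cell h @^-1` [set k] : set 'rV[R]_d).
    by rewrite -[X in measurable X]setTI; exact: mc.
  exact: (etrans (Y1mu _ mk) (esym (Y2mu _ mk))).
exists Q; split => //; apply: filterS Qae => z /= cz.
exact: le_trans (cell_sqnorm h0 cz) dh.
Qed.

(** * Square-integrable random vectors *)

Section L2rv.
Context {R : realType} {d : nat} {dO} {O : measurableType dO}.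
Variable P : probability O R.
Implicit Types (X Y : O -> 'rV[R]_d) (f g : O -> R).

Definition L2rv X :=
  measurable_fun setT X /\ (\int[P]_w (sqnorm (X w))%:E < +oo)%E.

Definition integ f := P.-integrable setT (EFin \o f).

Lemma integD f g : integ f -> integ g -> integ (fun w => f w + g w).
Proof. by move=> f1 g1; exact: (integrableD measurableT f1 g1). Qed.

Lemma integZ c f : integ f -> integ (fun w => c * f w).
Proof. by move=> f1; exact: (integrableZl measurableT c f1). Qed.

Lemma measurable_sqnorm X : measurable_fun setT X ->
  measurable_fun setT (fun w => sqnorm (X w)).
Proof. by move=> mX; exact: measurable_dotrv. Qed.

Lemma L2rv_sqnorm X : L2rv X -> integ (fun w => sqnorm (X w)).
Proof.
move=> [mX iX]; apply/integrableP; split.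
  by apply/measurable_EFinP; exact: measurable_sqnorm.
under eq_integral do rewrite /= ger0_norm ?sqnorm_ge0//.
exact: iX.
Qed.

Lemma le_integ f g : measurable_fun setT f -> (forall w, `|f w| <= g w) ->
  integ g -> integ f.
Proof.
move=> mf fg ig; apply: le_integrable ig => //; first exact/measurable_EFinP.
by move=> w _ /=; rewrite lee_fin (le_trans (fg w))// ler_norm.
Qed.

Lemma L2rv_le X g : measurable_fun setT X -> (forall w, sqnorm (X w) <= g w) ->
  integ g -> L2rv X.
Proof.
move=> mX Xg ig; split=> //.
have iX : integ (fun w => sqnorm (X w)).
  apply: le_integ ig; first exact: measurable_sqnorm.
  by move=> w; rewrite ger0_norm ?sqnorm_ge0.
have := integrable_fin_num measurableT iX.
by rewrite ge0_fin_numE// integral_ge0// => w _; rewrite lee_fin sqnorm_ge0.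
Qed.

Lemma L2rv_dot X Y : L2rv X -> L2rv Y -> integ (fun w => dotrv (X w) (Y w)).
Proof.
move=> hX hY; apply: le_integ (integD (L2rv_sqnorm hX) (L2rv_sqnorm hY)).
  by case: hX hY => [mX _] [mY _]; exact: measurable_dotrv.
by move=> w; exact: normr_dotrv_le.
Qed.

Lemma L2rvZ c X : L2rv X -> L2rv (fun w => c *: X w).
Proof.
move=> hX; apply: L2rv_le (integZ (c ^+ 2) (L2rv_sqnorm hX)).
  by case: hX => mX _; exact: measurable_rVZ.
by move=> w; rewrite sqnormZ.
Qed.

Lemma L2rvD X Y : L2rv X -> L2rv Y -> L2rv (fun w => X w + Y w).
Proof.
move=> hX hY.
apply: L2rv_le (integD (integZ 2 (L2rv_sqnorm hX)) (integZ 2 (L2rv_sqnorm hY))).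
  by case: hX hY => [mX _] [mY _]; exact: measurable_rVD.
by move=> w; exact: sqnormD_le.
Qed.

Lemma L2rvB X Y : L2rv X -> L2rv Y -> L2rv (fun w => X w - Y w).
Proof.
move=> hX /(L2rvZ (-1)) /(L2rvD hX); congr L2rv.
by apply/funext => w; rewrite scaleN1r.
Qed.

Lemma Rintegral_comb2 a b f g : integ f -> integ g ->
  \int[P]_w (a * f w + b * g w) = a * (\int[P]_w f w) + b * (\int[P]_w g w).
Proof.
by move=> f1 g1; rewrite RintegralD// ?RintegralZl//; exact: integZ.
Qed.

Lemma le_Rintegral_comb2 a b f g h : integ f -> integ g -> integ h ->
  (forall w, f w <= a * g w + b * h w) ->
  \int[P]_w f w <= a * (\int[P]_w g w) + b * (\int[P]_w h w).
Proof.
move=> f1 g1 h1 H; rewrite -Rintegral_comb2//; apply: le_Rintegral => //.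
by apply: integD; exact: integZ.
Qed.

Lemma le_Rintegral_comb3 (a b c a' b' c' : R) f g h f' g' h' :
  integ f -> integ g -> integ h -> integ f' -> integ g' -> integ h' ->
  (forall w, a * f w + b * g w + c * h w <= a' * f' w + b' * g' w + c' * h' w) ->
  a * (\int[P]_w f w) + b * (\int[P]_w g w) + c * (\int[P]_w h w) <=
  a' * (\int[P]_w f' w) + b' * (\int[P]_w g' w) + c' * (\int[P]_w h' w).
Proof.
move=> f1 g1 h1 f1' g1' h1' H.
have aux (x y z : R) u v w : integ u -> integ v -> integ w ->
    x * (\int[P]_o u o) + y * (\int[P]_o v o) + z * (\int[P]_o w o) =
    \int[P]_o (x * u o + y * v o + z * w o).
  move=> iu iv iw; rewrite -Rintegral_comb2// -RintegralZl// -RintegralD//.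
    by apply: integD; exact: integZ.
  exact: integZ.
rewrite !aux//; apply: le_Rintegral => //.
- by apply: integD; [apply: integD|]; exact: integZ.
- by apply: integD; [apply: integD|]; exact: integZ.
Qed.

End L2rv.

(** * The Wasserstein distance through random variables *)

Section wasserstein_rv.
Context {R : realType} {d : nat}.
Local Notation Rd := 'rV[R]_d.
Implicit Types mu nu : P2 R d.

Lemma couplingP mu nu gamma :
  coupling mu nu gamma <-> image_law gamma fst mu /\ image_law gamma snd nu.
Proof.
split=> [[g1 g2]|[[_ g1] [_ g2]]]; last by split.
by split; split=> //; do ?[exact: measurable_fst|exact: measurable_snd].
Qed.

Section on_space.
Context {dO} {O : measurableType dO}.
Variable P : probability O R.
Implicit Types X Y : O -> Rd.

Lemma L2rv_image_law X mu : image_law P X mu -> L2rv P X.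
Proof.
move=> Xmu; split; first by case: Xmu.
rewrite -(ge0_integral_image_law (g := fun x => (sqnorm x)%:E) Xmu).
- exact: P2_moment.
- by apply/measurable_EFinP; exact: measurable_sqnorm.
- by move=> y; rewrite lee_fin sqnorm_ge0.
Qed.

Lemma P2_image_law X : L2rv P X -> exists mu, image_law P X mu.
Proof.
move=> [mX iX]; have [Q XQ] := image_law_exists P mX.
suff mQ : (\int[Q]_x (sqnorm x)%:E < +oo)%E by exists (MkP2 mQ).
rewrite (ge0_integral_image_law (g := fun x => (sqnorm x)%:E) XQ)//.
- by apply/measurable_EFinP; exact: measurable_sqnorm.
- by move=> y; rewrite lee_fin sqnorm_ge0.
Qed.

Lemma coupling_image_law X Y mu nu : image_law P X mu -> image_law P Y nu ->
  exists2 gamma, coupling mu nu gamma & image_law P (fun w => (X w, Y w)) gamma.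
Proof.
move=> Xmu Ynu.
have mXY : measurable_fun setT (fun w => (X w, Y w)).
  by apply: measurable_fun_pair; [case: Xmu|case: Ynu].
have [gamma hg] := image_law_exists P mXY.
exists gamma => //; split=> A mA.
- rewrite -(proj2 hg); last by rewrite -[X in measurable X]setTI; exact: measurable_fst.
  by case: Xmu => _; exact.
- rewrite -(proj2 hg); last by rewrite -[X in measurable X]setTI; exact: measurable_snd.
  by case: Ynu => _; exact.
Qed.

End on_space.

Lemma measurable_cost : measurable_fun setT (fun z : Rd * Rd => sqnorm (z.1 - z.2)).
Proof.
apply: measurable_sqnorm; rewrite (_ : (fun _ => _) = fun z : Rd * Rd => z.1 + (-1) *: z.2).
  apply: measurable_rVD; first exact: measurable_fst.
  by apply: measurable_rVZ; exact: measurable_snd.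
by apply/funext => z; rewrite scaleN1r.
Qed.

Lemma costE mu nu gamma : coupling mu nu gamma ->
  cost gamma = (\int[gamma]_z sqnorm (z.1 - z.2))%:E.
Proof.
move=> /couplingP[g1 g2]; rewrite /Rintegral fineK//.
apply: integrable_fin_num => //.
exact: (L2rv_sqnorm (L2rvB (L2rv_image_law g1) (L2rv_image_law g2))).
Qed.

(** Constant labels leave a single fibre of full mass, so the glued measure is the product. Its
    existence makes the infimum in [W2sq] finite. *)
Lemma product_coupling mu nu : exists gamma, coupling mu nu gamma.
Proof.
have [//|//|k|Q [Q1 Q2 _]] :=
    @discrete_glue R _ _ _ _ (P2_prob mu) (P2_prob nu) (cst 0%N) (cst 0%N).
  have H (Q : probability Rd R) : (Q (cst 0%N @^-1` [set k]) = (0%N == k)%:R%:E)%E.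
    case: eqP => k0.
      by rewrite (_ : cst 0%N @^-1` _ = setT) ?probability_setT//; apply/seteqP; split=> x /=.
    by rewrite (_ : cst 0%N @^-1` _ = set0) ?measure0//; apply/seteqP; split=> x /=.
  exact: etrans (H _) (esym (H _)).
by exists Q; apply/couplingP.
Qed.

Lemma W2sq_inf mu nu : (W2sq mu nu)%:E =
  ereal_inf [set cost gamma | gamma in coupling mu nu].
Proof.
rewrite /W2sq fineK// ge0_fin_numE.
  have [gamma hg] := product_coupling mu nu.
  apply: le_lt_trans (ereal_inf_lbound _) _; first by exists gamma.
  by rewrite (costE hg) ltry.
apply: le_ereal_inf_tmp => _ [gamma _ <-].
by apply: integral_ge0 => z _; rewrite lee_fin sqnorm_ge0.
Qed.

Lemma W2sq_ge0 mu nu : 0 <= W2sq mu nu.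
Proof.
rewrite -lee_fin W2sq_inf; apply: le_ereal_inf_tmp => _ [gamma _ <-].
by apply: integral_ge0 => z _; rewrite lee_fin sqnorm_ge0.
Qed.

Lemma W2sq_le {dO} {O : measurableType dO} (P : probability O R) X Y mu nu :
  image_law P X mu -> image_law P Y nu ->
  W2sq mu nu <= \int[P]_w sqnorm (X w - Y w).
Proof.
move=> Xmu Ynu; have [gamma hg XYg] := coupling_image_law Xmu Ynu.
rewrite -(Rintegral_image_law (g := fun z : Rd * Rd => sqnorm (z.1 - z.2)) XYg);
  last exact: measurable_cost.
rewrite -lee_fin W2sq_inf -(costE hg).
by apply: ereal_inf_lbound; exists gamma.
Qed.

Lemma W2sq_near mu nu e : 0 < e -> exists2 gamma, coupling mu nu gamma &
  \int[gamma]_z sqnorm (z.1 - z.2) < W2sq mu nu + e.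
Proof.
move=> e0; have := @lb_ereal_inf_adherent R [set cost gamma | gamma in coupling mu nu] e e0.
rewrite -W2sq_inf => /(_ erefl)[_ [gamma hg <-]].
by rewrite (costE hg) -EFinD lte_fin; exists gamma.
Qed.

Lemma W2sqC mu nu : W2sq mu nu = W2sq nu mu.
Proof.
suff H mu' nu' : W2sq mu' nu' <= W2sq nu' mu' by apply/eqP; rewrite eq_le !H.
apply/ler_addgt0Pr => e e0.
have [gamma /couplingP[g1 g2] ge] := W2sq_near nu' mu' e0.
apply: le_trans (W2sq_le g2 g1) _; apply: le_trans (ltW ge).
by under eq_Rintegral do rewrite sqnorm_subC.
Qed.

(* On an enlargement of the space of [X], a nearly optimal partner of [X]: the
   gluing of couplings needs no disintegration if an error is allowed. *)
Lemma near_optimal_extension {dO} {O : measurableType dO} (P : probability O R)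
    (X : O -> Rd) mu nu e : image_law P X mu -> 0 < e ->
  exists (Q : probability (O * (Rd * Rd))%type R) (Z : O * (Rd * Rd) -> Rd),
  [/\ image_law Q fst P, image_law Q Z nu &
      \int[Q]_w sqnorm (X w.1 - Z w) <= W2sq mu nu + e].
Proof.
move=> Xmu e0; have split3 (w : R) : e / 3 + (w + e / 3 + e / 3) <= w + e by lra.
have e3 : 0 < e / 3 by rewrite divr_gt0.
have [gamma /couplingP[g1 g2] ge] := W2sq_near mu nu e3.
(* Weight for Young's inequality: dividing [W2sq + e / 3] by [a] costs only another [e / 3]. The
   gluing error is chosen as [(1 - a) * (e / 3)], so that division by [1 - a] leaves [e / 3]. The
   extra [e / 3] in the numerator keeps [a] positive when the distance is zero. *)
pose a := (W2sq mu nu + e / 3) / (W2sq mu nu + e / 3 + e / 3).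
have W0 := W2sq_ge0 mu nu.
have s0 : 0 < W2sq mu nu + e / 3 by rewrite ltr_wpDl.
have ss0 : 0 < W2sq mu nu + e / 3 + e / 3 by rewrite addr_gt0.
have a0 : 0 < a by rewrite divr_gt0.
have a1 : 0 < 1 - a by rewrite subr_gt0 ltr_pdivrMr// mul1r ltrDl.
have [Q [Q1 Q2 Qae]] := approx_glue Xmu g1 (mulr_gt0 a1 e3).
have X1 : image_law Q (X \o fst) mu := image_law_comp Q1 Xmu.
have X2 : image_law Q (fst \o snd) mu := image_law_comp Q2 g1.
have Z2 : image_law Q (snd \o snd) nu := image_law_comp Q2 g2.
exists Q, (snd \o snd); split=> //.
have L1 := L2rv_image_law X1; have L2 := L2rv_image_law X2; have L3 := L2rv_image_law Z2.
have I12 : \int[Q]_w sqnorm ((X \o fst) w - (fst \o snd) w) <= (1 - a) * (e / 3).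
  rewrite -lee_fin /Rintegral fineK; last first.
    exact: (integrable_fin_num measurableT (L2rv_sqnorm (L2rvB L1 L2))).
  apply: (@le_trans _ _ (\int[Q]_w ((1 - a) * (e / 3))%:E)%E); last first.
    by rewrite integral_cst// [X in (_ * X)%E]probability_setT mule1.
  apply: ae_ge0_le_integral => //.
  - by move=> w _; rewrite lee_fin sqnorm_ge0.
  - apply/measurable_EFinP; apply: measurable_sqnorm; exact: (L2rvB L1 L2).1.
  - by move=> w _; rewrite lee_fin mulr_ge0// ltW.
  - by apply: filterS Qae => w /= + _; rewrite lee_fin.
have I23 : \int[Q]_w sqnorm ((fst \o snd) w - (snd \o snd) w) <= W2sq mu nu + e / 3.
  apply: le_trans (ltW ge).
  by rewrite (Rintegral_image_law (g := fun z : Rd * Rd => sqnorm (z.1 - z.2)) Q2)//;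
    exact: measurable_cost.
apply: le_trans (le_Rintegral_comb2 (L2rv_sqnorm (L2rvB L1 L3))
  (L2rv_sqnorm (L2rvB L1 L2)) (L2rv_sqnorm (L2rvB L2 L3)) _) _.
  by move=> w; apply: (@sqnorm_sub_young _ _ (1 - a) a) => //; exact: subrK.
have H1 : (1 - a)^-1 * (\int[Q]_w sqnorm ((X \o fst) w - (fst \o snd) w)) <= e / 3.
  by rewrite ler_pdivrMl// (le_trans I12)// mulrC.
have H2 : a^-1 * (\int[Q]_w sqnorm ((fst \o snd) w - (snd \o snd) w)) <=
    W2sq mu nu + e / 3 + e / 3.
  by rewrite ler_pdivrMl// (le_trans I23)// /a divfK// lt0r_neq0.
exact: le_trans (lerD H1 H2) (split3 _).
Qed.

End wasserstein_rv.

(** * The sup-convolution and its semiconcavity *)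

Section regularization.
Context {R : realType} {d : nat}.
Local Notation Rd := 'rV[R]_d.
Implicit Types mu nu : P2 R d.

(** Young's inequality integrated along a nearly optimal pair for [mu1], [mu2], extended by a nearly
    optimal partner of the second variable. The errors carry factors [delta] and [1 - delta] that
    cancel the weights. It bounds the set whose supremum is [Phi_reg]. *)
Lemma W2sq_young (delta : R) mu1 mu2 nu : 0 < delta < 1 ->
  W2sq mu1 nu <= delta^-1 * W2sq mu1 mu2 + (1 - delta)^-1 * W2sq mu2 nu.
Proof.
move=> /andP[d0 d1]; have dd0 : 0 < 1 - delta by rewrite subr_gt0.
apply/ler_addgt0Pr => e e0; have e2 : 0 < e / 2 by rewrite divr_gt0.
have [gamma /couplingP[g1 g2] ge] := W2sq_near mu1 mu2 (mulr_gt0 d0 e2).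
have [Q [Z [Q1 Q2 Qe]]] := near_optimal_extension nu g2 (mulr_gt0 dd0 e2).
have X1 := image_law_comp Q1 g1; have X2 := image_law_comp Q1 g2.
have L1 := L2rv_image_law X1; have L2 := L2rv_image_law X2.
have L3 := L2rv_image_law Q2.
apply: le_trans (W2sq_le X1 Q2) _.
apply: le_trans (le_Rintegral_comb2 (L2rv_sqnorm (L2rvB L1 L3))
  (L2rv_sqnorm (L2rvB L1 L2)) (L2rv_sqnorm (L2rvB L2 L3)) _) _.
  by move=> w; apply: (@sqnorm_sub_young _ _ delta (1 - delta)) => //; exact: subrKC.
rewrite -(Rintegral_image_law (g := fun z : Rd * Rd => sqnorm (z.1 - z.2)) Q1);
  last exact: measurable_cost.
have H1 : delta^-1 * (\int[gamma]_z sqnorm (z.1 - z.2)) <=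
    delta^-1 * W2sq mu1 mu2 + e / 2.
  by rewrite ler_pdivrMl// mulrDr mulVKf ?lt0r_neq0// ltW.
have H2 : (1 - delta)^-1 * (\int[Q]_w sqnorm ((snd \o fst) w - Z w)) <=
    (1 - delta)^-1 * W2sq mu2 nu + e / 2.
  by rewrite ler_pdivrMl// mulrDr mulVKf ?lt0r_neq0.
by apply: le_trans (lerD H1 H2) _; rewrite addrACA -splitr.
Qed.

Let competitors nu (delta : R) mu :=
  [set W2sq mu' nu - delta^-1 * W2sq mu' mu | mu' in [set: P2 R d]].

Let competitors_ub nu delta mu : 0 < delta < 1 ->
  ubound (competitors nu delta mu) ((1 - delta)^-1 * W2sq mu nu).
Proof.
by move=> dd _ [mu' _ <-]; rewrite lerBlDl; exact: W2sq_young.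
Qed.

Let competitors_has_sup nu delta mu : 0 < delta < 1 ->
  has_sup (competitors nu delta mu).
Proof.
move=> dd; split; first by exists (W2sq mu nu - delta^-1 * W2sq mu mu), mu.
by exists ((1 - delta)^-1 * W2sq mu nu); exact: competitors_ub.
Qed.

Lemma Phi_reg_le nu delta mu : 0 < delta < 1 ->
  Phi_reg nu delta mu <= (1 - delta)^-1 * W2sq mu nu.
Proof.
move=> dd; apply: ge_sup; last exact: competitors_ub.
by case: (competitors_has_sup nu mu dd).
Qed.

Lemma Phi_reg_ge nu delta mu mu' : 0 < delta < 1 ->
  W2sq mu' nu - delta^-1 * W2sq mu' mu <= Phi_reg nu delta mu.
Proof.
move=> dd; apply: sup_upper_bound; last by exists mu'.
exact: competitors_has_sup.
Qed.

Lemma Phi_reg_near nu delta mu e : 0 < delta < 1 -> 0 < e ->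
  exists mu', Phi_reg nu delta mu - e < W2sq mu' nu - delta^-1 * W2sq mu' mu.
Proof.
move=> dd e0.
by have [_ [mu' _ <-] ?] := sup_adherent e0 (competitors_has_sup nu mu dd); exists mu'.
Qed.

(** Arithmetic of [Phi_reg_interp]. [F], [F'] are the values of [Phi_reg] at [mu0] and [mut]; [w],
    [p], [q] are squared distances to [nu] and [w'], [s] are the penalties; [k], [l], [m], [n], [r]
    are the integrals of [sqnorm_interp] that bound or approximate them; [u] is the interpolation
    error. *)
Let interp_arith (t delta e F F' w w' p q s u k l m n r : R) :
  0 < delta -> 0 <= t <= 1 -> 0 < e ->
  F - e / 3 < w - delta^-1 * w' ->
  p - delta^-1 * s <= F' ->
  w <= k -> q <= l -> s <= m -> n <= p + e / 3 -> r <= w' + delta * (e / 3) ->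
  (1 - t) * k + t * l + delta^-1 * m <= 1 * n + (1 - t) / delta * r + u ->
  (1 - t) * F + t * q <= F' + u + e.
Proof.
move=> d0 /andP[t0 t1] e0 hF hF' wk ql sm np rw H.
have t1' : 0 <= 1 - t by rewrite subr_ge0.
have dV0 : 0 <= delta^-1 by rewrite invr_ge0 ltW.
have A1 := ler_wpM2l t1' (ltW hF).
have A2 := ler_wpM2l t1' wk.
have A3 := ler_wpM2l t0 ql.
have A4 := ler_wpM2l dV0 sm.
have A5 : (1 - t) / delta * r <= (1 - t) / delta * w' + (1 - t) * (e / 3).
  have := ler_wpM2l (mulr_ge0 t1' dV0) rw; rewrite mulrDr.
  by rewrite -[(1 - t) / delta * (delta * _)]mulrA mulKf// lt0r_neq0.
have A6 : (1 - t) * (e / 3) <= e / 3 by rewrite ler_piMl ?gerBl// divr_ge0// ltW.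
move: A1 A5 H; rewrite -[(1 - t) / delta * w']mulrA.
set x := delta^-1 * w'; set y := _ / delta * r; set z := delta^-1 * _ in A4 *.
move: hF' A4; set z' := delta^-1 * s; lra.
Qed.

(** Semiconcavity along a segment, with the regularized value at [X] but [W2sq] itself at [Y]. A
    near-maximizer [X'] for [X] is interpolated with [Y]; the result competes in the supremum at
    [mut], and [sqnorm_interp] compares the costs. *)
Lemma Phi_reg_interp {dO} {O : measurableType dO} (P : probability O R)
    (X Y : O -> Rd) (nu mu0 mu1 mut : P2 R d) (delta t : R) :
  0 < delta < 1 -> 0 <= t <= 1 -> image_law P X mu0 -> image_law P Y mu1 ->
  image_law P (fun w => (1 - t) *: X w + t *: Y w) mut ->
  (1 - t) * Phi_reg nu delta mu0 + t * W2sq mu1 nu <=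
  Phi_reg nu delta mut +
    t * (1 - t) / (1 - delta) * (\int[P]_w sqnorm (Y w - X w)).
Proof.
move=> dd t01 X0 Y1 Mt; have /andP[d0 d1] := dd.
apply/ler_addgt0Pr => e e0; have e3 : 0 < e / 3 by rewrite divr_gt0.
have [mu' hmu'] := Phi_reg_near nu mu0 dd e3.
have [Q [X' [Q1 X'mu Qe]]] := near_optimal_extension mu' X0 (mulr_gt0 d0 e3).
have XQ := image_law_comp Q1 X0; have YQ := image_law_comp Q1 Y1.
have MQ := image_law_comp Q1 Mt.
have LX := L2rv_image_law XQ; have LY := L2rv_image_law YQ.
have LX' := L2rv_image_law X'mu.
(* The competitor at [mut] is the law [mut'] of [(1 - t) X' + t Y]. Below, [Z] is its nearly optimal
   partner of law [nu], tested also against [X'] and [Y]. *)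
have LM' := L2rvD (L2rvZ (1 - t) LX') (L2rvZ t LY).
have [mut' M't] := P2_image_law LM'.
have [S [Z [S1 Zmu Se]]] := near_optimal_extension nu M't e3.
have XS := image_law_comp S1 XQ; have YS := image_law_comp S1 YQ.
have X'S := image_law_comp S1 X'mu.
have MS := image_law_comp S1 MQ; have M'S := image_law_comp S1 M't.
have {}LX := L2rv_image_law XS; have {}LY := L2rv_image_law YS.
have {}LX' := L2rv_image_law X'S; have {}LM' := L2rv_image_law M'S.
have LM := L2rv_image_law MS; have LZ := L2rv_image_law Zmu.
have K := @le_Rintegral_comb3 R _ _ S (1 - t) t delta^-1 1 ((1 - t) / delta)
  (t * (1 - t) / (1 - delta)) _ _ _ _ _ _
  (L2rv_sqnorm (L2rvB LX' LZ)) (L2rv_sqnorm (L2rvB LY LZ))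
  (L2rv_sqnorm (L2rvB LM' LM)) (L2rv_sqnorm (L2rvB LM' LZ))
  (L2rv_sqnorm (L2rvB LX' LX)) (L2rv_sqnorm (L2rvB LY LX)).
have {K} := K (fun w => sqnorm_interp _ _ _ _ dd t01).
have mXX : measurable_fun setT (fun w => sqnorm (X' w - (X \o fst) w)).
  by apply: measurable_sqnorm; exact: (L2rvB (L2rv_image_law X'mu) (L2rv_image_law XQ)).1.
have -> : \int[S]_w sqnorm ((Y \o fst \o fst) w - (X \o fst \o fst) w) =
    \int[P]_w sqnorm (Y w - X w).
  rewrite -(Rintegral_image_law (g := fun w => sqnorm (Y w - X w)) (image_law_comp S1 Q1))//.
  by apply: measurable_sqnorm; exact: (L2rvB (L2rv_image_law Y1) (L2rv_image_law X0)).1.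
apply: interp_arith hmu' (Phi_reg_ge nu mut mut' dd) (W2sq_le X'S Zmu)
  (W2sq_le YS Zmu) (W2sq_le M'S MS) Se _ => //.
rewrite -(Rintegral_image_law S1 mXX) W2sqC.
by under eq_Rintegral do rewrite sqnorm_subC.
Qed.

End regularization.

(** Arithmetic of [gradient_gap_estimate]: the hypotheses are the expansions of [Phi] at [X] towards
    [Y] (distance [2 * r]) and towards [X'] (distance [r]), then the superdifferential inequality at
    [X']. The two remainders add up to [3 * (e * r)]. *)
Lemma gap_le {R : realType} (rN F fmu fmun fY A sB1 sB2 e r C : R) :
  `|fY - fmu - (A - sB2)| <= e * (2 * r) -> `|fmun - fmu - A| <= e * r ->
  fY <= F - sB1 + C -> sB1 - sB2 = rN ->
  rN <= F - fmun + 3 * (e * r) + C.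
Proof. by rewrite !ler_norml => /andP[h1 h2] /andP[h3 h4] h5 <-; lra. Qed.

(** * Expansions along random variables, and the gap between gradients *)

Section differentiability.
Context {R : realType} {d : nat}.
Local Notation Rd := 'rV[R]_d.

Lemma L2rv_L2vec {dO} {O : measurableType dO} (P : probability O R) (X : O -> Rd)
    (mu : P2 R d) (psi : Rd -> Rd) :
  image_law P X mu -> L2vec mu psi -> L2rv P (fun w => psi (X w)).
Proof.
move=> Xmu [mpsi ipsi]; split; first by case: Xmu => mX _; exact: measurableT_comp.
rewrite -(ge0_integral_image_law (g := fun x => (sqnorm (psi x))%:E) Xmu)//.
- by apply/measurable_EFinP; exact: measurable_sqnorm.
- by move=> y; rewrite lee_fin sqnorm_ge0.
Qed.

(** Differentiability applied to the joint law of [X] and [Y]. Any upper bound [h] of their L2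
    distance is allowed, which spares computing square roots. *)
Lemma is_Dmu_image_law (Psi : P2 R d -> R) (mu : P2 R d) (psi : Rd -> Rd) (e : R) :
  is_Dmu Psi mu psi -> 0 < e -> exists2 eta : R, 0 < eta &
  forall dO (O : measurableType dO) (P : probability O R) (X Y : O -> Rd)
    (mu' : P2 R d) (h : R),
  image_law P X mu -> image_law P Y mu' -> 0 <= h < eta ->
  \int[P]_w sqnorm (Y w - X w) <= h ^+ 2 ->
  `|Psi mu' - Psi mu - \int[P]_w dotrv (psi (X w)) (Y w - X w)| <= e * h.
Proof.
move=> [[mpsi _] Dpsi] e0; have [eta eta0 H] := Dpsi e e0.
exists eta => // dO O P X Y mu' h Xmu Ymu' /andP[h0 heta] XYh.
have [gamma hg XYg] := coupling_image_law Xmu Ymu'.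
have costle : Num.sqrt (fine (cost gamma)) <= h.
  rewrite -(ger0_norm h0) -sqrtr_sqr ler_wsqrtr// (costE hg)/=.
  rewrite (Rintegral_image_law (g := fun z : Rd * Rd => sqnorm (z.1 - z.2)) XYg);
    last exact: measurable_cost.
  by under eq_Rintegral do rewrite sqnorm_subC.
have mdot : measurable_fun setT (fun z : Rd * Rd => dotrv (psi z.1) (z.2 - z.1)).
  apply: measurable_dotrv; first exact: measurableT_comp.
  rewrite (_ : (fun _ => _) = fun z : Rd * Rd => z.2 + (-1) *: z.1).
    apply: measurable_rVD; first exact: measurable_snd.
    by apply: measurable_rVZ; exact: measurable_fst.
  by apply/funext => z; rewrite scaleN1r.
have := H mu' gamma hg (le_lt_trans costle heta).
rewrite (Rintegral_image_law XYg mdot) => /le_trans; apply.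
by rewrite ler_wpM2l// ltW.
Qed.

(** Expand [Phi_reg] at [X] towards [(1 - t) X + t Y], insert this in [Phi_reg_interp], and divide
    by [t]; a small [t] makes the remainder at most [e]. *)
Lemma Phi_reg_superdifferential {dO} {O : measurableType dO} (P : probability O R)
    (X Y : O -> Rd) (nu mu0 mu1 : P2 R d) (delta : R) (psi : Rd -> Rd) :
  0 < delta < 1 -> is_Dmu (Phi_reg nu delta) mu0 psi ->
  image_law P X mu0 -> image_law P Y mu1 ->
  W2sq mu1 nu <= Phi_reg nu delta mu0 +
    \int[P]_w dotrv (psi (X w)) (Y w - X w) +
    (1 - delta)^-1 * (\int[P]_w sqnorm (Y w - X w)).
Proof.
move=> dd Dpsi X0 Y1; have /andP[d0 d1] := dd.
have LX := L2rv_image_law X0; have LY := L2rv_image_law Y1.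
have Lpsi := L2rv_L2vec X0 Dpsi.1.
have LYX := L2rvB LY LX.
set A := \int[P]_w dotrv _ _; set B := \int[P]_w sqnorm _.
have B0 : 0 <= B by apply: Rintegral_ge0 => w _; exact: sqnorm_ge0.
apply/ler_addgt0Pr => e e0.
(* A positive bound with [B <= b ^+ 2], even if [B = 0]. With accuracy [e / b] and radius [t * b],
   the remainder is exactly [t * e]. *)
pose b := B + 1.
have b0 : 0 < b by rewrite ltr_wpDl.
have Bb : B <= b ^+ 2 by rewrite /b; nra.
have [eta eta0 H] := is_Dmu_image_law Dpsi (divr_gt0 e0 b0).
pose t := Num.min 1 (eta / (2 * b)).
have t0 : 0 < t by rewrite lt_min ltr01 divr_gt0// mulr_gt0.
have t1 : t <= 1 by rewrite ge_min lexx.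
have tb : t * b < eta.
  have : t <= eta / (2 * b) by rewrite ge_min lexx orbT.
  rewrite ler_pdivlMr ?mulr_gt0// => tb.
  have : 0 < t * b by rewrite mulr_gt0.
  by lra.
have Lt := L2rvD (L2rvZ (1 - t) LX) (L2rvZ t LY).
have [mut Xt] := P2_image_law Lt.
have t01 : 0 <= t <= 1 by rewrite t1 ltW.
have I := Phi_reg_interp nu dd t01 X0 Y1 Xt.
have tE w : (1 - t) *: X w + t *: Y w - X w = t *: (Y w - X w).
  by apply/rowP => i; rewrite !mxE; ring.
have sqE : \int[P]_w sqnorm ((1 - t) *: X w + t *: Y w - X w) = t ^+ 2 * B.
  under eq_Rintegral do rewrite tE sqnormZ.
  by rewrite RintegralZl//; exact: L2rv_sqnorm.
have dotE : \int[P]_w dotrv (psi (X w)) ((1 - t) *: X w + t *: Y w - X w) = t * A.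
  under eq_Rintegral do rewrite tE dotrvZr.
  by rewrite RintegralZl//; exact: L2rv_dot.
have := H _ _ P X _ mut (t * b) X0 Xt.
rewrite sqE dotE tb (mulr_ge0 (ltW t0) (ltW b0)) exprMn => /(_ isT).
rewrite ler_wpM2l ?sqr_ge0// => /(_ isT).
rewrite ler_norml => /andP[_].
rewrite [e / b * _]mulrC -mulrA [b * _]mulrC divfK ?lt0r_neq0// => J.
move: I; rewrite -/B -[t * (1 - t) / _]mulrA -[t * _ * B]mulrA => I.
set F := Phi_reg nu delta mu0 in I J *; set F' := Phi_reg nu delta mut in I J.
set W := W2sq mu1 nu in I *.
have C : (1 - t) / (1 - delta) * B <= (1 - delta)^-1 * B.
  rewrite ler_wpM2r// ler_piMl ?gerBl ?(ltW t0)//.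
  by rewrite invr_ge0 subr_ge0 ltW.
have {}C := ler_wpM2l (ltW t0) C.
rewrite -(ler_pM2l t0) !mulrDr.
set u := t * (_ / _ * _) in I C; set v := t * (_^-1 * _) in C *.
by clear -I J C; lra.
Qed.

(** The three terms on the right are the excess of [Phi_reg] over [Phi] at [mu'], the remainders of
    [Phi] at [mu], and the semiconcavity error. The expansion of [Phi] is assumed with given [e] and
    [eta], so that these can be fixed before [mu'] and [delta] vary. *)
Lemma gradient_gap_estimate (nu mu mu' : P2 R d) (gamma : probability (Rd * Rd)%type R)
    (psi psi' : Rd -> Rd) (delta e eta r : R) :
  0 < delta < 1 ->
  L2vec mu psi ->
  (forall dO (O : measurableType dO) (P : probability O R) (X Y : O -> Rd)
    (mu'' : P2 R d) (h : R),
    image_law P X mu -> image_law P Y mu'' -> 0 <= h < eta ->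
    \int[P]_w sqnorm (Y w - X w) <= h ^+ 2 ->
    `|Phi nu mu'' - Phi nu mu - \int[P]_w dotrv (psi (X w)) (Y w - X w)| <= e * h) ->
  is_Dmu (Phi_reg nu delta) mu' psi' ->
  coupling mu mu' gamma ->
  0 < r -> 2 * r < eta -> 0 <= e ->
  \int[gamma]_z sqnorm (z.1 - z.2) <= r ^+ 2 ->
  r * Num.sqrt (\int[gamma]_z sqnorm (psi' z.2 - psi z.1)) <=
  (2 * r ^+ 2 + 2 * Phi nu mu) * (delta / (1 - delta)) + 3 * (e * r) +
    (1 - delta)^-1 * r ^+ 2.
Proof.
move=> dd Lpsi Dpsi Dpsi' /couplingP[g1 g2] r0 reta e0 hr; have /andP[d0 d1] := dd.
have dd0 : 0 < 1 - delta by rewrite subr_gt0.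
have L1 := L2rv_image_law g1; have L2 := L2rv_image_law g2.
have Lp := L2rv_L2vec g1 Lpsi; have Lp' := L2rv_L2vec g2 Dpsi'.1.
have LE := L2rvB Lp' Lp.
set N2 := \int[gamma]_z sqnorm (psi' _ - _).
have N20 : 0 <= N2 by apply: Rintegral_ge0 => w _; exact: sqnorm_ge0.
have f0 : 0 <= Phi nu mu by exact: W2sq_ge0.
have rhs2 : 0 <= (2 * r ^+ 2 + 2 * Phi nu mu) * (delta / (1 - delta)).
  apply: mulr_ge0; last by rewrite divr_ge0// ltW.
  by apply: addr_ge0; apply: mulr_ge0 => //; exact: sqr_ge0.
have hr' : \int[gamma]_z sqnorm (z.2 - z.1) <= r ^+ 2.
  by under eq_Rintegral do rewrite sqnorm_subC.
(* [Phi_reg_le] bounds the excess by [delta / (1 - delta)] times [W2sq mu' nu]; Young's inequality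
   with weights one half then replaces [mu'] by [mu]. *)
have gap : Phi_reg nu delta mu' - Phi nu mu' <=
    (2 * r ^+ 2 + 2 * Phi nu mu) * (delta / (1 - delta)).
  have dE : (1 - delta)^-1 = 1 + delta / (1 - delta) by field; rewrite lt0r_neq0.
  have H := Phi_reg_le nu mu' dd; rewrite dE mulrDl mul1r in H.
  apply: (@le_trans _ _ (delta / (1 - delta) * W2sq mu' nu)).
    by rewrite lerBlDl.
  rewrite [leLHS]mulrC ler_wpM2r ?divr_ge0 ?(ltW d0) ?(ltW dd0)//.
  have half : 0 < (2^-1 : R) < 1 by rewrite invr_gt0 ltr0n invf_lt1 ?ltr1n.
  have Y := W2sq_young mu' mu nu half.
  have W := le_trans (W2sq_le g2 g1) hr'.
  have h2 : (1 - 2^-1 : R)^-1 = 2 by field.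
  by move: Y; rewrite h2 invrK /Phi => Y; clear -d Y W; lra.
(* For equal gradients the direction below cannot be normalized, but the left-hand side is zero. *)
have [N0|Nn0] := eqVneq N2 0.
  rewrite N0 sqrtr0 mulr0 !addr_ge0//.
    by rewrite mulr_ge0// mulr_ge0// ltW.
  by rewrite mulr_ge0 ?sqr_ge0// invr_ge0 ltW.
have N2p : 0 < N2 by rewrite lt_def Nn0.
set N := Num.sqrt N2.
have Np : 0 < N by rewrite sqrtr_gt0.
have NN : N2 = N ^+ 2 by rewrite sqr_sqrtr.
(* With this step, [Y = X' - s (p' - p)] is at L2 distance exactly [r] from [X'], hence at most
   [2 * r] from [X]. *)
pose s := r / N.
have LY := L2rvD L2 (L2rvZ (- s) LE).
have [muY hY] := P2_image_law LY.
have dY z : z.2 + (- s) *: (psi' z.2 - psi z.1) - z.2 = (- s) *: (psi' z.2 - psi z.1).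
  by rewrite addrC addKr.
have sqY : \int[gamma]_z sqnorm (z.2 + (- s) *: (psi' z.2 - psi z.1) - z.2) = r ^+ 2.
  under eq_Rintegral do rewrite dY sqnormZ.
  rewrite RintegralZl//; last exact: L2rv_sqnorm.
  by rewrite sqrrN -/N2 NN /s expr_div_n divfK// expf_neq0// lt0r_neq0.
have I1 := Phi_reg_superdifferential dd Dpsi' g2 hY.
move: I1; rewrite sqY.
set B1 := \int[gamma]_z dotrv (psi' z.2) (psi' z.2 - psi z.1).
have -> : \int[gamma]_z dotrv (psi' z.2) (z.2 + (- s) *: (psi' z.2 - psi z.1) - z.2)
    = - (s * B1).
  under eq_Rintegral do rewrite dY dotrvZr.
  by rewrite RintegralZl ?mulNr//; exact: L2rv_dot.
move=> I1.
have sq2 : \int[gamma]_z sqnorm (z.2 + (- s) *: (psi' z.2 - psi z.1) - z.1) <= (2 * r) ^+ 2.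
  apply: le_trans (le_Rintegral_comb2 (a := 2) (b := 2) (L2rv_sqnorm (L2rvB LY L1))
    (L2rv_sqnorm (L2rvB LY L2)) (L2rv_sqnorm (L2rvB L2 L1)) _) _.
    move=> z; apply: le_trans (sqnormD_le _ _).
    rewrite [X in sqnorm X <= _](_ : _ =
      (z.2 + (- s) *: (psi' z.2 - psi z.1) - z.2) + (z.2 - z.1))//.
    by rewrite addrA subrK.
  rewrite sqY.
  apply: (@le_trans _ _ (2 * r ^+ 2 + 2 * r ^+ 2)); first by rewrite lerD2l ler_wpM2l.
  by rewrite exprMn; clear -d; lra.
have r2 : 0 <= 2 * r < eta by rewrite reta mulr_ge0// ltW.
have r1 : 0 <= r < eta by rewrite ltW//= (le_lt_trans _ reta)//; clear -d r0; lra.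
have I2 := Dpsi _ _ gamma _ _ muY (2 * r) g1 hY r2 sq2.
have I3 := Dpsi _ _ gamma _ _ mu' r g1 g2 r1 hr'.
set A := \int[gamma]_z dotrv (psi z.1) (z.2 - z.1) in I3.
set B2 := \int[gamma]_z dotrv (psi z.1) (psi' z.2 - psi z.1).
have EE : \int[gamma]_z dotrv (psi z.1) (z.2 + (- s) *: (psi' z.2 - psi z.1) - z.1)
    = A - s * B2.
  have E1 z : dotrv (psi z.1) (z.2 + (- s) *: (psi' z.2 - psi z.1) - z.1) =
      1 * dotrv (psi z.1) (z.2 - z.1) + (- s) * dotrv (psi z.1) (psi' z.2 - psi z.1).
    rewrite (_ : z.2 + _ - z.1 = (z.2 - z.1) + (- s) *: (psi' z.2 - psi z.1)); last first.
      by rewrite addrAC.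
    by rewrite dotrvDr dotrvZr mul1r.
  under eq_Rintegral do rewrite E1.
  rewrite Rintegral_comb2; [|exact: L2rv_dot (L2rvB L2 L1)|exact: L2rv_dot].
  by rewrite mul1r mulNr.
rewrite EE in I2.
(* The linear terms differ by [s] times the squared norm of [p' - p], that is
   [s * N ^+ 2 = r * N]. *)
have BB : s * B1 - s * B2 = r * N.
  rewrite -mulrBr -RintegralB//; [|exact: L2rv_dot|exact: L2rv_dot].
  under eq_Rintegral do rewrite -dotrvBl.
  by rewrite -/N2 NN /s expr2 mulrA divfK ?lt0r_neq0.
have := gap_le I2 I3 I1 BB => /le_trans; apply.
by rewrite lerD2r lerD2r.
Qed.

End differentiability.

Theorem corollary5p3 (R : realType) (d : nat) (nu mu : P2 R d)
    (DPhi : 'rV[R]_d -> 'rV[R]_d) (delta : nat -> R) (mu_ : nat -> P2 R d)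
    (DPhi_reg : nat -> 'rV[R]_d -> 'rV[R]_d)
    (gamma_ : nat -> probability ('rV[R]_d * 'rV[R]_d)%type R) :
  is_Dmu (Phi nu) mu DPhi ->
  (forall n, 0 < delta n < 1) ->
  delta n @[n --> \oo] --> (0 : R) ->
  W2 (mu_ n) mu @[n --> \oo] --> (0 : R) ->
  (forall n, is_Dmu (Phi_reg nu (delta n)) (mu_ n) (DPhi_reg n)) ->
  (forall n, coupling mu (mu_ n) (gamma_ n)) ->
  (\int[gamma_ n]_z (sqnorm (z.1 - z.2))%:E)%E @[n --> \oo] --> (0 : \bar R) ->
  (\int[gamma_ n]_z (sqnorm (DPhi_reg n z.2 - DPhi z.1))%:E)%E
    @[n --> \oo] --> (0 : \bar R).
Proof.
move=> DPhimu d01 dto0 _ Dreg hgamma hto0.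
pose N2 n := \int[gamma_ n]_z sqnorm (DPhi_reg n z.2 - DPhi z.1).
have N20 n : 0 <= N2 n by apply: Rintegral_ge0 => w _; exact: sqnorm_ge0.
have -> : (fun n => \int[gamma_ n]_z (sqnorm (DPhi_reg n z.2 - DPhi z.1))%:E)%E
    = EFin \o N2.
  apply/funext => n; rewrite /N2 /Rintegral /= fineK//.
  have /couplingP[g1 g2] := hgamma n.
  apply: integrable_fin_num => //; apply: L2rv_sqnorm.
  exact: (L2rvB (L2rv_L2vec g2 (Dreg n).1) (L2rv_L2vec g1 DPhimu.1)).
have {}hto0 : (fun n => \int[gamma_ n]_z sqnorm (z.1 - z.2)) @ \oo --> (0 : R).
  exact: (fine_cvg hto0).
suff sqrt_small k : 0 < k -> \forall n \near \oo, Num.sqrt (N2 n) <= k.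
  apply: cvg_EFin; first exact: nearW.
  apply/cvgrPdist_le => e e0; near=> n.
  rewrite sub0r normrN ger0_norm//=.
  have : Num.sqrt (N2 n) <= Num.sqrt e by near: n; apply: sqrt_small; rewrite sqrtr_gt0.
  by rewrite ler_sqrt// ltW.
move=> k0.
(* The constants make each of the three terms of [gradient_gap_estimate] at most [r * (k / 4)]:
   accuracy [k / 12] for the remainders, [r <= k / 8] for the quadratic term, [delta n <= dl] for
   the excess. The radius [r] is fixed before [n] grows, and [r <= eta / 3] keeps [2 * r] below
   [eta]. *)
have k12 : 0 < k / 12 by rewrite divr_gt0.
have [eta eta0 Deta] := is_Dmu_image_law DPhimu k12.
pose r := Num.min (k / 8) (eta / 3).
have r0 : 0 < r by rewrite lt_min !divr_gt0.
have rk : 2 * r <= k / 4.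
  have : r <= k / 8 by rewrite ge_min lexx.
  by lra.
have reta : 2 * r < eta.
  have : r <= eta / 3 by rewrite ge_min lexx orbT.
  by lra.
pose M := 2 * r ^+ 2 + 2 * Phi nu mu.
have M0 : 0 < M by rewrite ltr_wpDr ?mulr_gt0 ?exprn_gt0 ?mulr_ge0 ?W2sq_ge0.
pose dl := Num.min (2^-1) (k * r / (8 * M)).
have dl0 : 0 < dl by rewrite lt_min invr_gt0 ltr0n divr_gt0 ?mulr_gt0.
near=> n.
have dn : delta n <= dl.
  rewrite -[delta n]ger0_norm; last by case/andP: (d01 n) => /ltW.
  rewrite -[X in `|X|]subr0 distrC; near: n.
  by move/cvgrPdist_le : dto0; exact.
have hn : \int[gamma_ n]_z sqnorm (z.1 - z.2) <= r ^+ 2.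
  apply: le_trans (ler_norm _) _; rewrite -normrN -[X in `|X|]sub0r; near: n.
  by move/cvgrPdist_le : hto0; apply; rewrite exprn_gt0.
have := gradient_gap_estimate (d01 n) DPhimu.1 Deta (Dreg n) (hgamma n) r0 reta (ltW k12) hn.
rewrite -/(N2 n) -/M => H.
have /andP[dn0 dn1] := d01 n.
have dn2 : delta n <= 2^-1 by rewrite (le_trans dn)// ge_min lexx.
(* The cap [2^-1] in [dl] bounds this factor uniformly in [n]. *)
have Ch : (1 - delta n)^-1 <= 2.
  by rewrite -[2]invrK lef_pV2 ?posrE ?subr_gt0 ?invr_gt0//; lra.
have H1 : M * (delta n / (1 - delta n)) <= r * (k / 4).
  have dM : delta n <= k * r / (8 * M) by rewrite (le_trans dn)// ge_min lexx orbT.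
  have {}dM : delta n * (8 * M) <= k * r by rewrite -ler_pdivlMr ?mulr_gt0.
  apply: (@le_trans _ _ (M * (delta n * 2))).
    by rewrite ler_pM2l// ler_pM2l.
  by clear -dM; lra.
have H2 : (1 - delta n)^-1 * r ^+ 2 <= r * (k / 4).
  apply: (@le_trans _ _ (2 * r ^+ 2)); first by rewrite ler_wpM2r ?sqr_ge0.
  by rewrite expr2 mulrA [leLHS]mulrC ler_pM2l.
rewrite -(ler_pM2l r0); apply: le_trans H _.
by clear -H1 H2 k0 r0; move: H1 H2; set x := M * _; set y := _ * r ^+ 2; nra.
Unshelve. all: by end_near.
Qed.
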